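(* Let $g:(0,+\infty)\to\mathbb{R}$ be convex and suppose the integral $\int_{1}^{+\infty}g(x)\,dx$ converges. Let $E:=\{(u,y)\in\mathbb{R}^2:\ (k+u)^2+y>0 \text{ for all } k\in\mathbb{N}\}$ (an open set). Then the function $$S(u,y):=\sum_{k=1}^{\infty}2(k+u)\,g((k+u)^2+y),\qquad (u,y)\in E,$$ is well defined and has the following properties. (1) $S\in C(E)$. If $(u_0,y_0)\in E$, then $(u_0,y)\in E$ for every $y>y_0$ and $\lim_{y\to+\infty}S(u_0,y)=0$. For every fixed $u\ge-1$, the function $y\mapsto S(u,y)$ is nonnegative, convex and decreasing on $(-(1+u)^2,+\infty)$. If, in addition, $g(x)>0$ for every $x>0$, then for every fixed $u\ge-1$ the function $y\mapsto S(u,y)$ is strictly decreasing on $(-(1+u)^2,+\infty)$. (2) Let $F(t):=\int_t^{+\infty}g(x)\,dx$ for $t>0$. For every $u\ge-1$ and $y$ with $u^2+u+y>0$, $$F((1+u)^2+y)+\left(\tfrac12+u\right)g((1+u)^2+y)\le S(u,y)\le F(u^2+u+y).$$ Moreover, the right-hand inequality is an equality if and only if $g$ is linear on each segment $[a_k,a_{k+1}]$, $k\in\mathbb{N}$, where $a_k=(k-\frac12+u)^2+y-\frac14$. The left-hand inequality is valid for every $u\ge-\frac32$ and $y>-(1+u)^2$, and it is an equality only if $g$ is linear on each segment $[s_k,s_{k+1}]$, $k\in\mathbb{N}$, where $s_k=(k+u)^2+y$.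
   Context: $\mathbb{N}=\{1,2,\dots\}$. ''Convex'' is the paper's ''convex downwards'': $g(\lambda x+(1-\lambda)y)\le\lambda g(x)+(1-\lambda)g(y)$ for $\lambda\in(0,1)$. ''Linear on a segment'' means affine there (degenerate one-point segments are allowed). ''Decreasing'' means non-increasing, as opposed to ''strictly decreasing''. *)

(* Defs.v *)
From Stdlib Require Import Reals.
From Coquelicot Require Import Coquelicot.
Open Scope R_scope.

Definition convex_on (D : R -> Prop) (f : R -> R) : Prop :=
  forall x y lam : R, D x -> D y -> 0 < lam < 1 ->
    f (lam * x + (1 - lam) * y) <= lam * f x + (1 - lam) * f y.

Definition decreasing_on (D : R -> Prop) (f : R -> R) : Prop :=
  forall x y : R, D x -> D y -> x < y -> f y <= f x.

Definition strictly_decreasing_on (D : R -> Prop) (f : R -> R) : Prop :=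
  forall x y : R, D x -> D y -> x < y -> f y < f x.

Definition linear_on_segment (g : R -> R) (a b : R) : Prop :=
  exists m c : R, forall x : R, a <= x <= b -> g x = m * x + c.

(* A function on (0, +oo) is represented by a total function R -> R whose
   values on (-oo, 0] are irrelevant: on E, the summand below evaluates g at
   positive points only. *)

Definition E (p : R * R) : Prop :=
  forall k : nat, (1 <= k)%nat -> (INR k + fst p) ^ 2 + snd p > 0.

Definition summand (g : R -> R) (u y : R) (k : nat) : R :=
  2 * (INR k + u) * g ((INR k + u) ^ 2 + y).

(* [Series] sums from index 0, whereas the sum starts at k = 1. *)
Definition Ssum (g : R -> R) (u y : R) : R :=
  Series (fun n : nat => summand g u y (S n)).

Definition Ftail (g : R -> R) (t : R) : R :=
  RInt_gen g (at_point t) (Rbar_locally p_infty).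

(* Main.v *)
Require Import Defs.
From Stdlib Require Import Reals Lra Lia Classical.
From Coquelicot Require Import Coquelicot.
Open Scope R_scope.

(** A convex function whose integral converges at infinity is nonnegative,
    decreasing and tends to 0: an increase would propagate by convexity to
    linear growth, and a negative value would persist, so that in both cases
    the integrals over intervals of length 1 far away could not be small.

    The factor [2 (k + u)] is the length of the interval from
    [(k - 1/2 + u)^2 + y - 1/4] to [(k + 1/2 + u)^2 + y - 1/4], and the
    midpoint of this interval is [(k + u)^2 + y]. When [k + u >= 0], the
    summand is therefore the midpoint rule for the integral of [g] over that
    interval. These intervals are consecutive, and the midpoint rule
    underestimates the integral of a convex function, with equality only for
    linear ones ([hermite_hadamard_midpoint]): summation gives convergence
    and the upper bound ([Ssum_le_Ftail]). The lower bound
    ([Ftail_le_Ssum]) comes in the same way from the trapezoid rule on the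
    intervals between the points [(k + u)^2 + y], of length
    [2 (k + u) + 1]; regrouping the trapezoids produces the summands and
    the boundary term [(1/2 + u) g((1 + u)^2 + y)]. In both cases the
    difference between the two sides for [N] terms increases with [N] from
    the value 0, so it vanishes in the limit if and only if every increment
    vanishes, that is, if every Hermite-Hadamard inequality used is an
    equality ([increasing_from_zero]).

    A general point of [E] may have finitely many terms with [k + u < 0].
    Since [Ssum g u y] is the sum of its first [N] terms and of
    [Ssum g (u + N) y] ([Ssum_split]), and the latter lies between 0 and the
    tail integral of [g] from [(u + N)^2 + (u + N) + y], which is small
    uniformly near a given point for large [N] ([locally_shift_large]),
    convergence, continuity and the limit at infinity all reduce to
    statements on finitely many terms. *)

(** * Convex functions on the positive half-line *)

Local Notation convex_pos g := (convex_on (fun x => 0 < x) g) (only parsing).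

Lemma convex_chord (g : R -> R) (g_convex : convex_pos g) (a x b : R) :
  0 < a -> a <= x <= b -> (b - a) * g x <= (b - x) * g a + (x - a) * g b.
Proof.
intros Ha [[Hax| ->] [Hxb| ->]]; try lra.
assert (Hl : 0 < (b - x) / (b - a) < 1).
{ split; [apply Rdiv_lt_0_compat; lra|].
  apply Rmult_lt_reg_r with (b - a); [lra|].
  unfold Rdiv; rewrite Rmult_assoc, Rinv_l; lra. }
assert (H := g_convex a b _ Ha ltac:(lra) Hl).
replace ((b - x) / (b - a) * a + (1 - (b - x) / (b - a)) * b) with x in H
  by (field; lra).
apply Rmult_le_compat_l with (r := b - a) in H; [|lra].
replace ((b - x) * g a + (x - a) * g b) with
  ((b - a) * ((b - x) / (b - a) * g a + (1 - (b - x) / (b - a)) * g b))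
  by (field; lra).
exact H.
Qed.

(** The slope is the supremum of the slopes of the chords ending at [m]: every
    chord starting at [m] has a slope that is an upper bound for them. *)
Lemma convex_support_line (g : R -> R) (g_convex : convex_pos g) (m : R) :
  0 < m -> exists p, forall x, 0 < x -> g m + p * (x - m) <= g x.
Proof.
intros Hm.
set (slopes := fun s => exists x, 0 < x < m /\ s = (g m - g x) / (m - x)).
assert (Hub : forall z, m < z -> is_upper_bound slopes ((g z - g m) / (z - m))).
{ intros z Hz s (x & Hx & ->).
  assert (H := convex_chord g g_convex x m z ltac:(lra) ltac:(lra)).
  apply Rmult_le_reg_r with ((m - x) * (z - m)).
  { apply Rmult_lt_0_compat; lra. }
  replace ((g m - g x) / (m - x) * ((m - x) * (z - m)))
    with ((g m - g x) * (z - m)) by (field; lra).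
  replace ((g z - g m) / (z - m) * ((m - x) * (z - m)))
    with ((g z - g m) * (m - x)) by (field; lra).
  lra. }
destruct (completeness slopes) as [p [Hp1 Hp2]].
{ exists ((g (m + 1) - g m) / (m + 1 - m)); apply Hub; lra. }
{ exists ((g m - g (m / 2)) / (m - m / 2)), (m / 2); split; [lra|reflexivity]. }
exists p; intros x Hx.
destruct (Rtotal_order x m) as [Hxm | [-> | Hxm]].
- assert (H : (g m - g x) / (m - x) <= p) by (apply Hp1; exists x; split; [lra|reflexivity]).
  apply Rmult_le_compat_r with (r := m - x) in H; [|lra].
  unfold Rdiv in H; rewrite Rmult_assoc, Rinv_l in H; lra.
- lra.
- assert (H := Hp2 _ (Hub x Hxm)).
  apply Rmult_le_compat_r with (r := x - m) in H; [|lra].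
  unfold Rdiv in H; rewrite Rmult_assoc, Rinv_l in H; lra.
Qed.

(** Near [m] the graph lies between a support line and two chords through
    [(m, g m)], so the increments of [g] are bounded by those of a linear
    function. *)
Lemma convex_continuous (g : R -> R) (g_convex : convex_pos g) (m : R) :
  0 < m -> continuous g m.
Proof.
intros Hm.
destruct (convex_support_line g g_convex m Hm) as [p Hp].
set (q := (g (2 * m) - g m) / m); set (r := (g (m / 2) - g m) / (m / 2)).
(* the summand 1 makes [C] positive, so that [eps / C] makes sense *)
set (C := Rabs p + Rabs q + Rabs r + 1).
assert (HC : 0 < C).
{ unfold C; generalize (Rabs_pos p), (Rabs_pos q), (Rabs_pos r); lra. }
assert (Hlip : forall x, Rabs (x - m) < m / 2 -> Rabs (g x - g m) <= C * Rabs (x - m)).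
{ intros x Hx; apply Rabs_def2 in Hx.
  assert (Hlow := Hp x ltac:(lra)).
  assert (Hl : - (Rabs p * Rabs (x - m)) <= p * (x - m)).
  { rewrite <- Rabs_mult; generalize (Rle_abs (- (p * (x - m)))); rewrite Rabs_Ropp; lra. }
  assert (Hup : g x - g m <= (Rabs q + Rabs r) * Rabs (x - m)).
  { generalize (Rabs_pos q), (Rabs_pos r), (Rle_abs q), (Rle_abs r); intros.
    destruct (Rle_lt_dec m x).
    - rewrite (Rabs_pos_eq (x - m)) by lra.
      assert (H3 := convex_chord g g_convex m x (2 * m) Hm ltac:(lra)).
      assert (g x - g m <= q * (x - m)).
      { apply Rmult_le_reg_l with m; [lra|].
        replace (m * (q * (x - m))) with ((g (2 * m) - g m) * (x - m))
          by (unfold q; field; lra). lra. }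
      assert (q * (x - m) <= (Rabs q + Rabs r) * (x - m))
        by (apply Rmult_le_compat_r; lra). lra.
    - rewrite (Rabs_left (x - m)) by lra.
      assert (H3 := convex_chord g g_convex (m / 2) x m ltac:(lra) ltac:(lra)).
      assert (g x - g m <= r * (- (x - m))).
      { apply Rmult_le_reg_l with (m / 2); [lra|].
        replace (m / 2 * (r * (- (x - m)))) with ((g (m / 2) - g m) * (m - x))
          by (unfold r; field; lra). lra. }
      assert (r * - (x - m) <= (Rabs q + Rabs r) * - (x - m))
        by (apply Rmult_le_compat_r; lra). lra. }
  assert (HA := Rabs_pos (x - m)).
  assert (0 <= Rabs p * Rabs (x - m)) by (apply Rmult_le_pos; apply Rabs_pos).
  assert (0 <= (Rabs q + Rabs r) * Rabs (x - m)).
  { apply Rmult_le_pos; [|apply Rabs_pos].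
    generalize (Rabs_pos q), (Rabs_pos r); lra. }
  apply Rabs_le; unfold C; split; lra. }
apply filterlim_locally; intros eps.
assert (Hd : 0 < Rmin (m / 2) (eps / C)).
{ apply Rmin_pos; [lra|]. apply Rdiv_lt_0_compat; [apply cond_pos|exact HC]. }
exists (mkposreal _ Hd); intros x Hx.
change (Rabs (x - m) < Rmin (m / 2) (eps / C)) in Hx.
change (Rabs (g x - g m) < eps).
assert (H1 := Rmin_l (m / 2) (eps / C)); assert (H2 := Rmin_r (m / 2) (eps / C)).
apply Rle_lt_trans with (C * Rabs (x - m)); [apply Hlip; lra|].
replace (pos eps) with (C * (eps / C)) by (field; lra).
apply Rmult_lt_compat_l; lra.
Qed.

Lemma convex_ex_RInt (g : R -> R) (g_convex : convex_pos g) (a b : R) :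
  0 < a -> 0 < b -> ex_RInt g a b.
Proof.
intros Ha Hb; apply (ex_RInt_continuous (V := R_CompleteNormedModule)).
intros z [Hz _]; apply convex_continuous; [exact g_convex|].
apply Rlt_le_trans with (2 := Hz); apply Rmin_pos; assumption.
Qed.

Lemma convex_RInt_Chasles (g : R -> R) (g_convex : convex_pos g) (a b c : R) :
  0 < a -> 0 < b -> 0 < c -> RInt g a b + RInt g b c = RInt g a c.
Proof.
intros; apply (RInt_Chasles (V := R_CompleteNormedModule));
  apply convex_ex_RInt; assumption.
Qed.

(** * The two Hermite-Hadamard inequalities and their equality cases *)

Lemma is_RInt_affine (p c a b : R) :
  is_RInt (fun x => p * x + c) a b (p * (b ^ 2 - a ^ 2) / 2 + c * (b - a)).
Proof.
replace (p * (b ^ 2 - a ^ 2) / 2 + c * (b - a)) with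
  (minus (p * b ^ 2 / 2 + c * b) (p * a ^ 2 / 2 + c * a))
  by (unfold minus, plus, opp; simpl; field).
apply (is_RInt_derive (V := R_CompleteNormedModule) (fun x => p * x ^ 2 / 2 + c * x)).
- intros x _; auto_derive; [exact I|field].
- intros x _; apply (ex_derive_continuous (V := R_NormedModule)); auto_derive; exact I.
Qed.

Lemma RInt_linear (g : R -> R) (a b : R) :
  a <= b -> linear_on_segment g a b -> RInt g a b = (b - a) * g ((a + b) / 2).
Proof.
intros Hab (p & c & Hg).
rewrite (RInt_ext _ (fun x => p * x + c)).
- rewrite (is_RInt_unique _ _ _ _ (is_RInt_affine p c a b)).
  rewrite Hg by lra; apply Rminus_diag_uniq; field.
- rewrite Rmin_left, Rmax_right by lra; intros; apply Hg; lra.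
Qed.

(** By continuity, a strict inequality at one point persists on a
    nondegenerate subinterval next to it, over which the integral of [h - f]
    is then positive. *)
Lemma RInt_eq_pointwise (f h : R -> R) (a b : R) :
  a < b ->
  (forall x, a <= x <= b -> continuous f x) ->
  (forall x, a <= x <= b -> continuous h x) ->
  (forall x, a <= x <= b -> f x <= h x) ->
  RInt f a b = RInt h a b -> forall x, a <= x <= b -> f x = h x.
Proof.
intros Hab Hf Hh Hfh Heq x Hx.
apply Rle_antisym; [apply Hfh, Hx|apply Rnot_lt_le; intros Hlt].
set (d := fun z => h z - f z).
assert (Hd : forall z, a <= z <= b -> continuous d z).
{ intros z Hz; apply (continuous_minus (V := R_NormedModule)); auto. }
assert (Hex : forall c e, a <= c -> c <= e -> e <= b -> ex_RInt d c e).
{ intros c e H1 H2 H3; apply (ex_RInt_continuous (V := R_CompleteNormedModule)).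
  rewrite Rmin_left, Rmax_right by lra; intros z Hz; apply Hd; lra. }
assert (Hint : RInt d a b = 0).
{ replace 0 with (minus (RInt h a b) (RInt f a b))
    by (rewrite Heq; unfold minus, plus, opp; simpl; ring).
  apply (RInt_minus (V := R_CompleteNormedModule));
  apply (ex_RInt_continuous (V := R_CompleteNormedModule));
  rewrite Rmin_left, Rmax_right by lra; auto. }
assert (Hdx : 0 < d x) by (unfold d; lra).
destruct (proj1 (filterlim_locally d (d x)) (Hd x Hx) (mkposreal _ Hdx)) as [del Hdel].
assert (Hdel0 := cond_pos del).
assert (Hpos : forall z, Rabs (z - x) < del -> 0 < d z).
{ intros z Hz. specialize (Hdel z Hz).
  change (Rabs (d z - d x) < d x) in Hdel. apply Rabs_def2 in Hdel; lra. }
assert (Hsub : exists c e, a <= c /\ c < e /\ e <= b /\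
          forall z, c < z < e -> Rabs (z - x) < del).
{ destruct (Rlt_le_dec x b) as [Hxb|Hxb].
  - exists x, (Rmin b (x + del)).
    generalize (Rmin_l b (x + del)), (Rmin_r b (x + del)); intros.
    repeat split; [lra | apply Rmin_glb_lt; lra | lra |].
    intros z Hz; apply Rabs_def1; lra.
  - exists (Rmax a (x - del)), x.
    generalize (Rmax_l a (x - del)), (Rmax_r a (x - del)); intros.
    repeat split; [lra | apply Rmax_lub_lt; lra | lra |].
    intros z Hz; apply Rabs_def1; lra. }
destruct Hsub as (c & e & Hac & Hce & Heb & Hce_del).
assert (H1 : 0 < RInt d c e).
{ apply RInt_gt_0; auto. intros; apply Hd; lra. }
assert (Hge : forall l r, a <= l -> l <= r -> r <= b -> 0 <= RInt d l r).
{ intros l r Hl Hlr Hr; apply RInt_ge_0; auto.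
  intros z Hz; unfold d; generalize (Hfh z ltac:(lra)); lra. }
assert (H2 := Hge a c ltac:(lra) ltac:(lra) ltac:(lra)).
assert (H3 := Hge e b ltac:(lra) ltac:(lra) ltac:(lra)).
assert (H4 := RInt_Chasles (V := R_CompleteNormedModule) d a c e
  (Hex a c ltac:(lra) ltac:(lra) ltac:(lra)) (Hex c e ltac:(lra) ltac:(lra) ltac:(lra))).
assert (H5 := RInt_Chasles (V := R_CompleteNormedModule) d a e b
  (Hex a e ltac:(lra) ltac:(lra) ltac:(lra)) (Hex e b ltac:(lra) ltac:(lra) ltac:(lra))).
unfold plus in H4, H5; simpl in H4, H5. lra.
Qed.

Lemma continuous_affine (p c x : R) : continuous (fun x => p * x + c) x.
Proof.
apply (ex_derive_continuous (V := R_NormedModule)); auto_derive; exact I.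
Qed.

Lemma linear_on_point (g : R -> R) (a : R) : linear_on_segment g a a.
Proof. exists 0, (g a); intros x Hx; replace x with a by lra; ring. Qed.

(** The support line at the midpoint lies below [g] and has integral
    [(b - a) * g ((a + b) / 2)]; equality of the integrals forces [g] to
    coincide with it. *)
Lemma hermite_hadamard_midpoint (g : R -> R) (g_convex : convex_pos g) (a b : R) :
  0 < a -> a <= b ->
  (b - a) * g ((a + b) / 2) <= RInt g a b
  /\ ((b - a) * g ((a + b) / 2) = RInt g a b <-> linear_on_segment g a b).
Proof.
intros Ha Hab.
destruct (convex_support_line g g_convex ((a + b) / 2) ltac:(lra)) as [p Hp].
set (m := (a + b) / 2) in *. set (c := g m - p * m).
assert (Hint : RInt (fun x => p * x + c) a b = (b - a) * g m).
{ rewrite (is_RInt_unique _ _ _ _ (is_RInt_affine p c a b)).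
  apply Rminus_diag_uniq; unfold c, m; field. }
assert (Hle : forall x, a <= x <= b -> p * x + c <= g x).
{ intros x Hx; unfold c; generalize (Hp x ltac:(lra)); lra. }
split; [|split].
- rewrite <- Hint; apply RInt_le; auto.
  + eexists; apply is_RInt_affine.
  + apply convex_ex_RInt; auto; lra.
  + intros; apply Hle; lra.
- intros Heq.
  destruct Hab as [Hab| <-]; [|apply linear_on_point].
  exists p, c; intros x Hx; symmetry.
  apply (RInt_eq_pointwise (fun x => p * x + c) g a b); auto.
  + intros; apply continuous_affine.
  + intros; apply convex_continuous; auto; lra.
  + rewrite Hint; exact Heq.
- intros Hlin; symmetry; apply RInt_linear; assumption.
Qed.

(** Here [g] lies below its chord, whose integral is given by the trapezoid
    rule. *)
Lemma hermite_hadamard_trapezoid (g : R -> R) (g_convex : convex_pos g) (a b : R) :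
  0 < a -> a <= b ->
  RInt g a b <= (b - a) * ((g a + g b) / 2)
  /\ (RInt g a b = (b - a) * ((g a + g b) / 2) -> linear_on_segment g a b).
Proof.
intros Ha [Hab| <-].
2: { rewrite RInt_point; unfold zero; simpl; split; [lra|].
     intros _; apply linear_on_point. }
set (p := (g b - g a) / (b - a)); set (c := g a - p * a).
assert (Hint : RInt (fun x => p * x + c) a b = (b - a) * ((g a + g b) / 2)).
{ rewrite (is_RInt_unique _ _ _ _ (is_RInt_affine p c a b)).
  apply Rminus_diag_uniq; unfold c, p; field; lra. }
assert (Hle : forall x, a <= x <= b -> g x <= p * x + c).
{ intros x Hx; assert (H := convex_chord g g_convex a x b Ha Hx).
  apply Rmult_le_reg_l with (b - a); [lra|].
  replace ((b - a) * (p * x + c)) with ((b - x) * g a + (x - a) * g b)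
    by (unfold c, p; field; lra).
  exact H. }
rewrite <- Hint; split.
- apply RInt_le; [lra | apply convex_ex_RInt; auto; lra
                 | eexists; apply is_RInt_affine | intros; apply Hle; lra].
- intros Heq; exists p, c; intros x Hx.
  apply (RInt_eq_pointwise g (fun x => p * x + c) a b); auto.
  + intros; apply convex_continuous; auto; lra.
  + intros; apply continuous_affine.
Qed.

(** * Integrability at infinity *)

Local Notation integrable_at_infinity g :=
  (ex_RInt_gen g (at_point 1) (Rbar_locally p_infty)) (only parsing).

Lemma ex_RInt_gen_tail (g : R -> R) (g_convex : convex_pos g)
  (g_int : integrable_at_infinity g) (t : R) :
  0 < t -> ex_RInt_gen g (at_point t) (Rbar_locally p_infty).
Proof.
intros Ht; destruct g_int as [l Hl].
exists (plus (RInt g t 1) l).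
apply (is_RInt_gen_Chasles (V := R_NormedModule) g 1); [|exact Hl].
apply is_RInt_gen_at_point.
apply (RInt_correct (V := R_CompleteNormedModule)), convex_ex_RInt; auto; lra.
Qed.

Lemma Ftail_Chasles (g : R -> R) (g_convex : convex_pos g)
  (g_int : integrable_at_infinity g) (s t : R) :
  0 < s -> 0 < t -> Ftail g s = RInt g s t + Ftail g t.
Proof.
intros Hs Ht.
apply (@is_RInt_gen_unique R_CompleteNormedModule (at_point s)
  (Rbar_locally p_infty) _ _ g).
apply (is_RInt_gen_Chasles (V := R_NormedModule) g t).
- apply is_RInt_gen_at_point.
  apply (RInt_correct (V := R_CompleteNormedModule)), convex_ex_RInt; auto.
- apply (@RInt_gen_correct R_CompleteNormedModule (at_point t)
    (Rbar_locally p_infty) _ _ g), ex_RInt_gen_tail; assumption.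
Qed.

Lemma Ftail_small (g : R -> R) (g_convex : convex_pos g)
  (g_int : integrable_at_infinity g) (eps : R) :
  0 < eps -> exists M, 0 < M /\ forall t, M < t -> Rabs (Ftail g t) < eps.
Proof.
intros Heps.
assert (H := @RInt_gen_correct R_CompleteNormedModule (at_point 1)
  (Rbar_locally p_infty) _ _ g g_int).
destruct (proj1 (filterlimi_locally _ _) H (mkposreal _ Heps)) as [P Q HP [M HM] HPQ].
exists (Rmax M 1); split; [generalize (Rmax_r M 1); lra|]; intros t Ht.
generalize (Rmax_l M 1), (Rmax_r M 1); intros H1 H2.
destruct (HPQ 1 t HP (HM t ltac:(lra))) as [z [Hz Hball]].
simpl in Hz; apply (is_RInt_unique (V := R_CompleteNormedModule)) in Hz.
change (Rabs (z - Ftail g 1) < eps) in Hball.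
rewrite (Ftail_Chasles g g_convex g_int 1 t) in Hball by lra.
replace (z - (RInt g 1 t + Ftail g t)) with (- Ftail g t) in Hball
  by (rewrite <- Hz; ring).
rewrite Rabs_Ropp in Hball; exact Hball.
Qed.

(** Otherwise the integral of [g] over every interval [[t, t + 1]] far away
    is at least [eps], in contradiction with the Cauchy criterion. *)
Lemma exists_lt_far (g : R -> R) (g_convex : convex_pos g)
  (g_int : integrable_at_infinity g) (X eps : R) :
  0 < X -> 0 < eps -> exists z, X < z /\ g z < eps.
Proof.
intros HX Heps; apply NNPP; intros Hno.
destruct (Ftail_small g g_convex g_int (eps / 2) ltac:(lra)) as [M [HM0 HM]].
set (t := X + M + 1).
assert (H1 := HM t ltac:(unfold t; lra)); assert (H2 := HM (t + 1) ltac:(unfold t; lra)).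
rewrite (Ftail_Chasles g g_convex g_int t (t + 1)) in H1 by (unfold t; lra).
assert (H : RInt (fun _ => eps) t (t + 1) <= RInt g t (t + 1)).
{ apply RInt_le; [lra | apply (ex_RInt_const (V := R_NormedModule))
                 | apply convex_ex_RInt; auto; unfold t; lra |].
  intros x Hx; apply Rnot_lt_le; intros Hlt; apply Hno; exists x.
  split; [unfold t in Hx; lra|exact Hlt]. }
rewrite RInt_const in H; unfold scal in H; simpl in H; unfold mult in H; simpl in H.
apply Rabs_def2 in H1; apply Rabs_def2 in H2; lra.
Qed.

Lemma exists_gt_far (g : R -> R) (g_convex : convex_pos g)
  (g_int : integrable_at_infinity g) (X eps : R) :
  0 < X -> 0 < eps -> exists z, X < z /\ - eps < g z.
Proof.
intros HX Heps; apply NNPP; intros Hno.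
destruct (Ftail_small g g_convex g_int (eps / 2) ltac:(lra)) as [M [HM0 HM]].
set (t := X + M + 1).
assert (H1 := HM t ltac:(unfold t; lra)); assert (H2 := HM (t + 1) ltac:(unfold t; lra)).
rewrite (Ftail_Chasles g g_convex g_int t (t + 1)) in H1 by (unfold t; lra).
assert (H : RInt g t (t + 1) <= RInt (fun _ => - eps) t (t + 1)).
{ apply RInt_le; [lra | apply convex_ex_RInt; auto; unfold t; lra
                 | apply (ex_RInt_const (V := R_NormedModule)) |].
  intros x Hx; apply Rnot_lt_le; intros Hlt; apply Hno; exists x.
  split; [unfold t in Hx; lra|exact Hlt]. }
rewrite RInt_const in H; unfold scal in H; simpl in H; unfold mult in H; simpl in H.
apply Rabs_def2 in H1; apply Rabs_def2 in H2; lra.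
Qed.

(** An increase of [g] between two points would propagate, by convexity, to a
    growth at a linear rate. *)
Lemma integrable_convex_decreasing (g : R -> R) (g_convex : convex_pos g)
  (g_int : integrable_at_infinity g) (x y : R) :
  0 < x -> x <= y -> g y <= g x.
Proof.
intros Hx [Hxy| <-]; [|lra].
apply Rnot_lt_le; intros Hlt.
set (p := (g y - g x) / (y - x)).
assert (Hp : 0 < p) by (apply Rdiv_lt_0_compat; lra).
(* beyond [X] the line through the two points exceeds 1 *)
set (X := Rmax y (y + (1 - g y) / p)).
assert (HX1 : y <= X) by apply Rmax_l.
assert (HX2 : y + (1 - g y) / p <= X) by apply Rmax_r.
destruct (exists_lt_far g g_convex g_int X 1 ltac:(lra) ltac:(lra)) as [z [Hz Hgz]].
assert (H := convex_chord g g_convex x y z Hx ltac:(lra)).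
assert (H1 : g y + p * (z - y) <= g z).
{ apply Rmult_le_reg_l with (y - x); [lra|].
  replace ((y - x) * (g y + p * (z - y))) with
    ((y - x) * g y + (g y - g x) * (z - y)) by (unfold p; field; lra). lra. }
assert (H2 : 1 - g y <= p * (z - y)).
{ replace (1 - g y) with (p * ((1 - g y) / p)) by (field; lra).
  apply Rmult_le_compat_l; lra. }
lra.
Qed.

Lemma integrable_convex_nonneg (g : R -> R) (g_convex : convex_pos g)
  (g_int : integrable_at_infinity g) (x : R) : 0 < x -> 0 <= g x.
Proof.
intros Hx; apply Rnot_lt_le; intros Hlt.
destruct (exists_gt_far g g_convex g_int x (- g x) Hx ltac:(lra)) as [z [Hz Hgz]].
assert (H := integrable_convex_decreasing g g_convex g_int x z Hx ltac:(lra)). lra.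
Qed.

Lemma integrable_convex_lim (g : R -> R) (g_convex : convex_pos g)
  (g_int : integrable_at_infinity g) : is_lim g p_infty 0.
Proof.
apply is_lim_spec; intros eps.
destruct (exists_lt_far g g_convex g_int 1 eps ltac:(lra) (cond_pos eps)) as [z [Hz Hgz]].
exists z; intros x Hx; rewrite Rminus_0_r.
assert (H1 := integrable_convex_decreasing g g_convex g_int z x ltac:(lra) ltac:(lra)).
assert (H2 := integrable_convex_nonneg g g_convex g_int x ltac:(lra)).
rewrite Rabs_pos_eq; lra.
Qed.

(** If [g x = g y] with [x < y] then convexity gives [g z >= g y] for all
    [z > y], which is incompatible with [g > 0] and the limit 0. *)
Lemma integrable_convex_strictly_decreasing (g : R -> R) (g_convex : convex_pos g)
  (g_int : integrable_at_infinity g) (g_pos : forall x, x > 0 -> g x > 0) (x y : R) :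
  0 < x -> x < y -> g y < g x.
Proof.
intros Hx Hxy; apply Rnot_le_lt; intros Hle.
assert (Hy := g_pos y ltac:(lra)).
destruct (exists_lt_far g g_convex g_int y (g y) ltac:(lra) Hy) as [z [Hz Hgz]].
assert (H := convex_chord g g_convex x y z Hx ltac:(lra)).
assert ((z - y) * g x <= (z - y) * g y) by (apply Rmult_le_compat_l; lra).
assert ((y - x) * g z < (y - x) * g y) by (apply Rmult_lt_compat_l; lra).
lra.
Qed.

Lemma Ftail_nonneg (g : R -> R) (g_convex : convex_pos g)
  (g_int : integrable_at_infinity g) (t : R) : 0 < t -> 0 <= Ftail g t.
Proof.
intros Ht; apply Rnot_lt_le; intros Hlt.
destruct (Ftail_small g g_convex g_int (- Ftail g t) ltac:(lra)) as [M [HM0 HM]].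
assert (H := HM (M + t) ltac:(lra)); apply Rabs_def2 in H.
rewrite (Ftail_Chasles g g_convex g_int t (M + t)) in H, Hlt by lra.
assert (0 <= RInt g t (M + t)).
{ apply RInt_ge_0; [lra | apply convex_ex_RInt; auto; lra |].
  intros x Hx; apply integrable_convex_nonneg; auto; lra. }
lra.
Qed.

Lemma Ftail_lim (g : R -> R) (g_convex : convex_pos g)
  (g_int : integrable_at_infinity g) : is_lim (Ftail g) p_infty 0.
Proof.
apply is_lim_spec; intros eps.
destruct (Ftail_small g g_convex g_int eps (cond_pos eps)) as [M [_ HM]].
exists M; intros x Hx; rewrite Rminus_0_r; auto.
Qed.

Lemma RInt_lim_Ftail (g : R -> R) (g_convex : convex_pos g)
  (g_int : integrable_at_infinity g) (t : R) (b : nat -> R) :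
  0 < t -> (forall n, 0 < b n) -> is_lim_seq b p_infty ->
  is_lim_seq (fun n => RInt g t (b n)) (Ftail g t).
Proof.
intros Ht Hb Hlim.
apply is_lim_seq_ext with (fun n => Ftail g t - Ftail g (b n)).
{ intros n; rewrite (Ftail_Chasles g g_convex g_int t (b n)) by auto; ring. }
replace (Finite (Ftail g t)) with (Finite (Ftail g t - 0)) by (f_equal; ring).
apply is_lim_seq_minus'; [apply is_lim_seq_const|].
apply (is_lim_comp_seq (Ftail g) b p_infty 0).
- apply Ftail_lim; assumption.
- exists 0%nat; intros; discriminate.
- exact Hlim.
Qed.

(** * The series and its comparison with the integral *)

Definition head (g : R -> R) (u y : R) (N : nat) : R :=
  sum_n_m (summand g u y) 1 N.

Lemma head_0 (g : R -> R) (u y : R) : head g u y 0 = 0.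
Proof. apply (sum_n_m_zero (G := R_AbelianMonoid)); lia. Qed.

Lemma head_S (g : R -> R) (u y : R) (N : nat) :
  head g u y (S N) = head g u y N + summand g u y (S N).
Proof. apply (sum_n_Sm (G := R_AbelianMonoid)); lia. Qed.

Lemma sum_n_head (g : R -> R) (u y : R) (N : nat) :
  sum_n (fun n => summand g u y (S n)) N = head g u y (S N).
Proof. apply (sum_n_m_S (G := R_AbelianMonoid)). Qed.

Lemma head_lim (g : R -> R) (u y : R) :
  ex_series (fun n => summand g u y (S n)) ->
  is_lim_seq (head g u y) (Ssum g u y).
Proof.
intros H; apply is_lim_seq_incr_1.
apply is_lim_seq_ext with (sum_n (fun n => summand g u y (S n))).
{ intros n; apply sum_n_head. }
exact (Series_correct _ H).
Qed.

(** Shifting [u] by an integer moves the summation index: this reduces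
    every point of [E] to the case of nonnegative terms. *)
Lemma summand_shift (g : R -> R) (u y : R) (N k : nat) :
  summand g (u + INR N) y k = summand g u y (N + k).
Proof.
unfold summand; rewrite plus_INR.
replace (INR k + (u + INR N)) with (INR N + INR k + u) by ring; reflexivity.
Qed.

Lemma E_shift (u y : R) (N : nat) : E (u, y) -> E (u + INR N, y).
Proof.
intros H k Hk; simpl; generalize (H (N + k)%nat ltac:(lia)); simpl.
rewrite plus_INR; replace (INR N + INR k + u) with (INR k + (u + INR N)) by ring; auto.
Qed.

Lemma INR_ge_1 (k : nat) : (1 <= k)%nat -> 1 <= INR k.
Proof. intros H; apply (le_INR 1 k H). Qed.

(** For [u < -3/2] the first argument [(1 + u) ^ 2 + y] would no longer be the
    smallest one. *)
Lemma node_ge (u y : R) (k : nat) :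
  u >= - (3 / 2) -> (1 <= k)%nat -> (1 + u) ^ 2 + y <= (INR k + u) ^ 2 + y.
Proof.
intros Hu Hk; induction Hk as [|k Hk IH]; [simpl; lra|].
rewrite S_INR; generalize (INR_ge_1 k Hk); intros.
assert (0 <= (INR k + 1 + u) ^ 2 - (INR k + u) ^ 2).
{ replace ((INR k + 1 + u) ^ 2 - (INR k + u) ^ 2) with (2 * (INR k + u) + 1) by ring; lra. }
lra.
Qed.

Lemma E_halfplane (u y : R) : u >= - (3 / 2) -> y > - (1 + u) ^ 2 -> E (u, y).
Proof.
intros Hu Hy k Hk; simpl fst; simpl snd; generalize (node_ge u y k Hu Hk); lra.
Qed.

Lemma summand_nonneg (g : R -> R) (g_convex : convex_pos g)
  (g_int : integrable_at_infinity g) (u y : R) (k : nat) :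
  E (u, y) -> (1 <= k)%nat -> 0 <= INR k + u -> 0 <= summand g u y k.
Proof.
intros HE Hk Hu; apply Rmult_le_pos; [lra|].
apply integrable_convex_nonneg; auto; apply HE; assumption.
Qed.

(** The factors [2 (k + u)] are the lengths of consecutive intervals with
    midpoints [(k + u) ^ 2 + y]; these are their endpoints. *)
Definition cell (u y : R) (k : nat) : R := (INR k - 1 / 2 + u) ^ 2 + y - 1 / 4.

Lemma cell_length (u y : R) (k : nat) :
  cell u y (S k) - cell u y k = 2 * (INR k + u).
Proof. unfold cell; rewrite S_INR; field. Qed.

Lemma cell_midpoint (u y : R) (k : nat) :
  (cell u y k + cell u y (S k)) / 2 = (INR k + u) ^ 2 + y.
Proof. unfold cell; rewrite S_INR; field. Qed.

Lemma cell_1 (u y : R) : cell u y 1 = u ^ 2 + u + y.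
Proof. unfold cell; simpl; field. Qed.

Lemma cell_ge (u y : R) (k : nat) :
  u >= -1 -> (1 <= k)%nat -> u ^ 2 + u + y <= cell u y k.
Proof.
intros Hu Hk; induction Hk as [|k Hk IH]; [rewrite cell_1; lra|].
generalize (cell_length u y k) (INR_ge_1 k Hk); lra.
Qed.

Lemma square_lim (w c : R) : is_lim_seq (fun n => (INR (S n) + w) ^ 2 + c) p_infty.
Proof.
apply is_lim_seq_le_p_loc with (fun n => INR n + (2 * w + 1 + c)).
- exists 0%nat; intros n _; rewrite S_INR.
  generalize (pos_INR n) (pow2_ge_0 (INR n + w)); intros; nra.
- apply is_lim_seq_plus with p_infty (2 * w + 1 + c);
    [apply is_lim_seq_INR | apply is_lim_seq_const | reflexivity].
Qed.

(** Such a sequence keeps any positive value that it attains, hence its limit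
    is 0 only if it is constant. Applied to the gap between the two sides of
    a comparison, this detects equality term by term. *)
Lemma increasing_from_zero (d : nat -> R) (l : R) :
  d 0%nat = 0 -> (forall n, d n <= d (S n)) -> is_lim_seq d l ->
  0 <= l /\ (l = 0 <-> forall n, d (S n) = d n).
Proof.
intros H0 Hincr Hlim.
assert (Hle := is_lim_seq_incr_compare d l Hlim Hincr).
assert (Hge : forall n, 0 <= d n).
{ intros n; induction n as [|n IH]; [lra|]; generalize (Hincr n); lra. }
split; [|split].
- generalize (Hle 0%nat); lra.
- intros -> n; generalize (Hle n) (Hle (S n)) (Hge n) (Hge (S n)); lra.
- intros Hc.
  assert (Hz : forall n, d n = 0) by (induction n; [|rewrite Hc]; assumption).
  assert (H := is_lim_seq_unique _ _ Hlim).
  rewrite (Lim_seq_ext d (fun _ => 0) Hz), Lim_seq_const in H; congruence.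
Qed.

Definition midpoint_gap (g : R -> R) (u y : R) (N : nat) : R :=
  RInt g (cell u y 1) (cell u y (S N)) - head g u y N.

Lemma midpoint_gap_0 (g : R -> R) (u y : R) : midpoint_gap g u y 0 = 0.
Proof. unfold midpoint_gap; rewrite head_0, RInt_point; unfold zero; simpl; ring. Qed.

Lemma midpoint_gap_incr (g : R -> R) (g_convex : convex_pos g) (u y : R) (N : nat) :
  u >= -1 -> u ^ 2 + u + y > 0 ->
  midpoint_gap g u y N <= midpoint_gap g u y (S N)
  /\ (midpoint_gap g u y (S N) = midpoint_gap g u y N <->
      linear_on_segment g (cell u y (S N)) (cell u y (S (S N)))).
Proof.
intros Hu Hy; unfold midpoint_gap; rewrite head_S.
assert (Hpos : forall k, (1 <= k)%nat -> 0 < cell u y k).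
{ intros k Hk; generalize (cell_ge u y k Hu Hk); lra. }
assert (HN := INR_ge_1 (S N) ltac:(lia)).
assert (Hlen := cell_length u y (S N)).
rewrite <- (convex_RInt_Chasles g g_convex (cell u y 1) (cell u y (S N))
  (cell u y (S (S N)))) by (apply Hpos; lia).
destruct (hermite_hadamard_midpoint g g_convex (cell u y (S N)) (cell u y (S (S N))))
  as [Hle Heq]; [apply Hpos; lia | lra |].
rewrite cell_midpoint, Hlen in Hle, Heq.
fold (summand g u y (S N)) in Hle, Heq.
split; [lra|]; rewrite <- Heq; split; lra.
Qed.

Lemma head_le_Ftail (g : R -> R) (g_convex : convex_pos g)
  (g_int : integrable_at_infinity g) (u y : R) (N : nat) :
  u >= -1 -> u ^ 2 + u + y > 0 -> head g u y N <= Ftail g (u ^ 2 + u + y).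
Proof.
intros Hu Hy.
assert (Hgap : 0 <= midpoint_gap g u y N).
{ induction N as [|N IH]; [rewrite midpoint_gap_0; lra|].
  generalize (proj1 (midpoint_gap_incr g g_convex u y N Hu Hy)); lra. }
unfold midpoint_gap in Hgap; rewrite cell_1 in Hgap.
assert (Hc := cell_ge u y (S N) Hu ltac:(lia)).
rewrite (Ftail_Chasles g g_convex g_int _ (cell u y (S N))) by lra.
generalize (Ftail_nonneg g g_convex g_int (cell u y (S N)) ltac:(lra)); lra.
Qed.

Lemma head_incr (g : R -> R) (g_convex : convex_pos g)
  (g_int : integrable_at_infinity g) (u y : R) (N : nat) :
  u >= -1 -> E (u, y) -> head g u y N <= head g u y (S N).
Proof.
intros Hu HE; rewrite head_S.
assert (HN := INR_ge_1 (S N) ltac:(lia)).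
generalize (summand_nonneg g g_convex g_int u y (S N) HE ltac:(lia) ltac:(lra)); lra.
Qed.

Lemma halfplane_of_cell (u y : R) : u >= -1 -> u ^ 2 + u + y > 0 -> - (1 + u) ^ 2 < y.
Proof. intros; lra. Qed.

Lemma ex_series_cell (g : R -> R) (g_convex : convex_pos g)
  (g_int : integrable_at_infinity g) (u y : R) :
  u >= -1 -> u ^ 2 + u + y > 0 -> ex_series (fun n => summand g u y (S n)).
Proof.
intros Hu Hy.
assert (HE := E_halfplane u y ltac:(lra) (halfplane_of_cell u y Hu Hy)).
destruct (ex_finite_lim_seq_incr (fun n => sum_n (fun k => summand g u y (S k)) n)
  (Ftail g (u ^ 2 + u + y))) as [l Hl].
- intros n; rewrite !sum_n_head; apply head_incr; auto.
- intros n; rewrite sum_n_head; apply head_le_Ftail; auto.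
- exists l; exact Hl.
Qed.

Lemma Ssum_le_Ftail (g : R -> R) (g_convex : convex_pos g)
  (g_int : integrable_at_infinity g) (u y : R) :
  u >= -1 -> u ^ 2 + u + y > 0 ->
  Ssum g u y <= Ftail g (u ^ 2 + u + y)
  /\ (Ssum g u y = Ftail g (u ^ 2 + u + y) <->
      forall k, (1 <= k)%nat -> linear_on_segment g (cell u y k) (cell u y (S k))).
Proof.
intros Hu Hy.
destruct (increasing_from_zero (midpoint_gap g u y)
  (Ftail g (u ^ 2 + u + y) - Ssum g u y)) as [H1 H2].
- apply midpoint_gap_0.
- intros n; apply midpoint_gap_incr; auto.
- apply is_lim_seq_minus'; [|apply head_lim, ex_series_cell; auto].
  rewrite cell_1; apply RInt_lim_Ftail; auto.
  + intros n; generalize (cell_ge u y (S n) Hu ltac:(lia)); lra.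
  + apply is_lim_seq_ext with (fun n => (INR (S n) + (u - 1 / 2)) ^ 2 + (y - 1 / 4));
      [intros n; unfold cell; field | apply square_lim].
- split; [lra|].
  assert (H3 : Ssum g u y = Ftail g (u ^ 2 + u + y) <->
               Ftail g (u ^ 2 + u + y) - Ssum g u y = 0) by (split; lra).
  rewrite H3, H2; split.
  + intros H [|k] Hk; [lia|]. apply (midpoint_gap_incr g g_convex u y k Hu Hy), H.
  + intros H n. apply (midpoint_gap_incr g g_convex u y n Hu Hy), H; lia.
Qed.

(** * Locally uniform smallness of the tails *)

(** With [v := u + N] and [N] large, the right end [v ^ 2 + v + y] of the
    integral comparison exceeds any bound on a whole neighbourhood. *)
Lemma locally_shift_large (u0 y0 M : R) :
  0 <= M ->
  exists N : nat, locally (u0, y0) (fun p : R * R =>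
    fst p + INR N >= -1 /\ (fst p + INR N) ^ 2 + (fst p + INR N) + snd p > M).
Proof.
intros HM.
destruct (INR_unbounded (M + Rabs y0 + 2 - u0)) as [N HN].
exists N, (mkposreal 1 Rlt_0_1); intros [u y] [Hu Hy]; simpl fst in *; simpl snd in *.
change (Rabs (u - u0) < 1) in Hu; change (Rabs (y - y0) < 1) in Hy.
apply Rabs_def2 in Hu; apply Rabs_def2 in Hy.
assert (Habs : - y0 <= Rabs y0) by (rewrite <- Rabs_Ropp; apply Rle_abs).
assert (Hpos := Rabs_pos y0).
assert (Hsq := pow2_ge_0 (u + INR N)).
split; lra.
Qed.

Lemma Ssum_split (g : R -> R) (u y : R) (N : nat) :
  ex_series (fun n => summand g u y (S n)) ->
  Ssum g u y = head g u y N + Ssum g (u + INR N) y.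
Proof.
intros Hex; induction N as [|N IH].
{ rewrite head_0, Rplus_0_l, Rplus_0_r; reflexivity. }
rewrite IH, head_S; unfold Ssum at 1; rewrite Series_incr_1.
- rewrite summand_shift; replace (N + 1)%nat with (S N) by lia.
  rewrite Rplus_assoc; do 2 f_equal; apply Series_ext; intros k.
  rewrite !summand_shift; f_equal; lia.
- apply (ex_series_incr_n (V := R_NormedModule) _ N) in Hex.
  revert Hex; apply ex_series_ext; intros k; rewrite summand_shift; f_equal; lia.
Qed.

Lemma ex_series_E (g : R -> R) (g_convex : convex_pos g)
  (g_int : integrable_at_infinity g) (u y : R) :
  E (u, y) -> ex_series (fun n => summand g u y (S n)).
Proof.
intros HE.
destruct (locally_shift_large u y 0 (Rle_refl 0)) as [N HN].
apply locally_singleton in HN; simpl fst in HN; simpl snd in HN.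
destruct HN as (Hu & Hy).
apply (ex_series_incr_n (V := R_NormedModule) _ N).
assert (H := ex_series_cell g g_convex g_int _ _ Hu Hy).
revert H; apply ex_series_ext; intros k; rewrite summand_shift; f_equal; lia.
Qed.

Lemma head_le_Ssum (g : R -> R) (g_convex : convex_pos g)
  (g_int : integrable_at_infinity g) (u y : R) (N : nat) :
  u >= -1 -> - (1 + u) ^ 2 < y -> head g u y N <= Ssum g u y.
Proof.
intros Hu Hy; assert (HE := E_halfplane u y ltac:(lra) Hy).
apply (is_lim_seq_incr_compare (head g u y) (Ssum g u y)).
- apply head_lim, ex_series_E; auto.
- intros n; apply head_incr; auto.
Qed.

Lemma Ssum_nonneg (g : R -> R) (g_convex : convex_pos g)
  (g_int : integrable_at_infinity g) (u y : R) :
  u >= -1 -> - (1 + u) ^ 2 < y -> 0 <= Ssum g u y.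
Proof.
intros Hu Hy; rewrite <- (head_0 g u y); apply head_le_Ssum; auto.
Qed.

(** The trapezoid rule gives the weight [k + u + 1/2] to [g] at both ends of the
    [k]-th interval, so that an inner point receives [2 (k + u)] in total. The
    first two terms and the third one together are the sum of the [N]
    trapezoids: the two boundary terms correct the weights at its ends. *)
Definition trapezoid_gap (g : R -> R) (u y : R) (N : nat) : R :=
  head g u y N + (INR N + u + 1 / 2) * g ((INR (S N) + u) ^ 2 + y)
  - (1 / 2 + u) * g ((1 + u) ^ 2 + y)
  - RInt g ((1 + u) ^ 2 + y) ((INR (S N) + u) ^ 2 + y).

Lemma trapezoid_gap_0 (g : R -> R) (u y : R) : trapezoid_gap g u y 0 = 0.
Proof.
unfold trapezoid_gap; rewrite head_0; simpl INR; rewrite RInt_point.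
unfold zero; simpl; ring.
Qed.

Lemma trapezoid_gap_incr (g : R -> R) (g_convex : convex_pos g) (u y : R) (N : nat) :
  u >= - (3 / 2) -> y > - (1 + u) ^ 2 ->
  trapezoid_gap g u y N <= trapezoid_gap g u y (S N)
  /\ (trapezoid_gap g u y (S N) = trapezoid_gap g u y N ->
      linear_on_segment g ((INR (S N) + u) ^ 2 + y) ((INR (S (S N)) + u) ^ 2 + y)).
Proof.
intros Hu Hy; unfold trapezoid_gap; rewrite head_S; unfold summand.
assert (Hpos : forall k, (1 <= k)%nat -> 0 < (INR k + u) ^ 2 + y).
{ intros k Hk; generalize (node_ge u y k Hu Hk); lra. }
assert (HN := INR_ge_1 (S N) ltac:(lia)).
assert (Hlen : (INR (S (S N)) + u) ^ 2 + y - ((INR (S N) + u) ^ 2 + y)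
               = 2 * (INR (S N) + u) + 1) by (rewrite (S_INR (S N)); ring).
rewrite <- (convex_RInt_Chasles g g_convex ((1 + u) ^ 2 + y)
  ((INR (S N) + u) ^ 2 + y) ((INR (S (S N)) + u) ^ 2 + y)) by (try (apply Hpos; lia); lra).
destruct (hermite_hadamard_trapezoid g g_convex ((INR (S N) + u) ^ 2 + y)
  ((INR (S (S N)) + u) ^ 2 + y)) as [Hle Heq]; [apply Hpos; lia | lra |].
rewrite Hlen in Hle, Heq.
assert (HSN : INR N = INR (S N) - 1) by (rewrite S_INR; ring).
rewrite HSN.
set (k := INR (S N)) in *; set (gk := g ((k + u) ^ 2 + y)) in *.
set (gk' := g ((INR (S (S N)) + u) ^ 2 + y)) in *.
split; [lra|]; intros H; apply Heq; lra.
Qed.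

(** The summand of index [N + 1], which tends to 0, dominates this boundary
    term. *)
Lemma trapezoid_boundary_lim (g : R -> R) (g_convex : convex_pos g)
  (g_int : integrable_at_infinity g) (u y : R) :
  u >= - (3 / 2) -> y > - (1 + u) ^ 2 -> E (u, y) ->
  is_lim_seq (fun N => (INR N + u + 1 / 2) * g ((INR (S N) + u) ^ 2 + y)) 0.
Proof.
intros Hu Hy HE.
apply is_lim_seq_incr_1.
apply is_lim_seq_le_le with (fun _ => 0) (fun N => summand g u y (S (S N))).
- intros n; unfold summand.
  assert (Hk := INR_ge_1 (S n) ltac:(lia)).
  assert (Hg : 0 <= g ((INR (S (S n)) + u) ^ 2 + y)).
  { apply integrable_convex_nonneg; auto; apply HE; lia. }
  rewrite (S_INR (S n)) in *; split.
  + apply Rmult_le_pos; lra.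
  + apply Rmult_le_compat_r; lra.
- apply is_lim_seq_const.
- apply (is_lim_seq_incr_1 (fun n => summand g u y (S n))).
  apply ex_series_lim_0, ex_series_E; auto.
Qed.

Lemma Ftail_le_Ssum (g : R -> R) (g_convex : convex_pos g)
  (g_int : integrable_at_infinity g) (u y : R) :
  u >= - (3 / 2) -> y > - (1 + u) ^ 2 ->
  Ftail g ((1 + u) ^ 2 + y) + (1 / 2 + u) * g ((1 + u) ^ 2 + y) <= Ssum g u y
  /\ (Ftail g ((1 + u) ^ 2 + y) + (1 / 2 + u) * g ((1 + u) ^ 2 + y) = Ssum g u y ->
      forall k, (1 <= k)%nat ->
        linear_on_segment g ((INR k + u) ^ 2 + y) ((INR (S k) + u) ^ 2 + y)).
Proof.
intros Hu Hy; assert (HE := E_halfplane u y Hu Hy).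
destruct (increasing_from_zero (trapezoid_gap g u y)
  (Ssum g u y + 0 - (1 / 2 + u) * g ((1 + u) ^ 2 + y) - Ftail g ((1 + u) ^ 2 + y)))
  as [H1 H2].
- apply trapezoid_gap_0.
- intros n; apply trapezoid_gap_incr; auto.
- apply is_lim_seq_minus'; [apply is_lim_seq_minus'; [apply is_lim_seq_plus'|]|].
  + apply head_lim, ex_series_E; auto.
  + apply trapezoid_boundary_lim; auto.
  + apply is_lim_seq_const.
  + apply RInt_lim_Ftail; auto; [lra | | apply square_lim].
    intros n; apply HE; lia.
- split; [lra|].
  intros Heq [|k] Hk; [lia|].
  apply (trapezoid_gap_incr g g_convex u y k Hu Hy), H2; lra.
Qed.

(** * Regularity of the sum *)

Lemma continuous_node (k : nat) (p : R * R) :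
  continuous (fun q : R * R => (INR k + fst q) ^ 2 + snd q) p.
Proof.
apply (continuous_plus (V := R_NormedModule)); [|apply continuous_snd].
apply (continuous_comp (fun q : R * R => fst q) (fun x => (INR k + x) ^ 2)).
- apply continuous_fst.
- apply (ex_derive_continuous (V := R_NormedModule)); auto_derive; exact I.
Qed.

Lemma continuous_head (g : R -> R) (g_convex : convex_pos g) (p : R * R) (N : nat) :
  E p -> continuous (fun q : R * R => head g (fst q) (snd q) N) p.
Proof.
intros HE; induction N as [|N IH].
- apply continuous_ext with (fun _ => 0); [intros q; symmetry; apply head_0|].
  apply continuous_const.
- apply continuous_ext with (fun q => plus (head g (fst q) (snd q) N)
    (mult (2 * (INR (S N) + fst q)) (g ((INR (S N) + fst q) ^ 2 + snd q)))).
  { intros q; symmetry; apply head_S. }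
  apply (continuous_plus (V := R_NormedModule)); [exact IH|].
  apply (continuous_mult (K := R_AbsRing)).
  + apply (continuous_comp (fun q : R * R => fst q) (fun x => 2 * (INR (S N) + x))).
    * apply continuous_fst.
    * apply (ex_derive_continuous (V := R_NormedModule)); auto_derive; exact I.
  + apply (continuous_comp (fun q : R * R => (INR (S N) + fst q) ^ 2 + snd q) g).
    * apply continuous_node.
    * apply convex_continuous; auto; apply HE; lia.
Qed.

(** Near a given point only finitely many of the conditions defining [E]
    need to be checked, and each of them is open. *)
Lemma open_E : open E.
Proof.
intros [u0 y0] HE.
destruct (locally_shift_large u0 y0 0 (Rle_refl 0)) as [N HN].
assert (Hhead : forall n, locally (u0, y0) (fun p : R * R => forall k,
          (1 <= k <= n)%nat -> (INR k + fst p) ^ 2 + snd p > 0)).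
{ induction n as [|n IH].
  - apply filter_forall; intros p k Hk; lia.
  - assert (H := continuous_node (S n) (u0, y0) (fun x => 0 < x)
      (open_gt 0 _ (HE (S n) ltac:(lia)))).
    generalize (filter_and _ _ IH H); apply filter_imp; intros p [H1 H2] k Hk.
    destruct (Nat.eq_dec k (S n)) as [->|]; [exact H2|apply H1; lia]. }
generalize (filter_and _ _ (Hhead N) HN); apply filter_imp.
intros [u y] [H1 (Hu & Hy)] k Hk; simpl fst in *; simpl snd in *.
destruct (Nat.le_gt_cases k N) as [Hle|Hgt]; [apply H1; lia|].
assert (H : E (u + INR N, y)) by (apply E_halfplane, halfplane_of_cell; lra).
specialize (H (k - N)%nat ltac:(lia)).
simpl fst in H; simpl snd in H; rewrite minus_INR in H by lia.
replace (INR k - INR N + (u + INR N)) with (INR k + u) in H by ring; exact H.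
Qed.

(** A finite sum differs from [Ssum] by less than [eps / 4] on a whole
    neighbourhood, and it is continuous. *)
Lemma continuous_Ssum (g : R -> R) (g_convex : convex_pos g)
  (g_int : integrable_at_infinity g) (p : R * R) :
  E p -> continuous (fun q : R * R => Ssum g (fst q) (snd q)) p.
Proof.
intros HE; apply filterlim_locally; intros eps.
destruct p as [u0 y0].
assert (Heps := cond_pos eps).
assert (He4 : 0 < eps / 4) by lra.
destruct (Ftail_small g g_convex g_int (eps / 4) He4) as [M [HM0 HM]].
destruct (locally_shift_large u0 y0 M ltac:(lra)) as [N HN].
assert (Hsplit : locally (u0, y0) (fun p : R * R =>
  head g (fst p) (snd p) N <= Ssum g (fst p) (snd p)
    < head g (fst p) (snd p) N + eps / 4)).
{ generalize (filter_and _ _ (open_E _ HE) HN); apply filter_imp.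
  intros [u y] [HEp (Hu & HyM)]; simpl fst in *; simpl snd in *.
  assert (Hy : (u + INR N) ^ 2 + (u + INR N) + y > 0) by lra.
  assert (HF := HM _ HyM); apply Rabs_def2 in HF.
  rewrite (Ssum_split g u y N) by (apply ex_series_E; auto).
  generalize (Ssum_nonneg g g_convex g_int _ _ Hu (halfplane_of_cell _ _ Hu Hy)).
  generalize (proj1 (Ssum_le_Ftail g g_convex g_int _ _ Hu Hy)); lra. }
assert (Hhead := proj1 (filterlim_locally _ _)
  (continuous_head g g_convex (u0, y0) N HE) (mkposreal _ He4)).
assert (H0 := locally_singleton _ _ Hsplit); simpl in H0.
generalize (filter_and _ _ Hsplit Hhead); apply filter_imp.
intros [u y] [H1 H2]; simpl fst in *; simpl snd in *.
change (Rabs (head g u y N - head g u0 y0 N) < eps / 4) in H2.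
change (Rabs (Ssum g u y - Ssum g u0 y0) < eps).
apply Rabs_def2 in H2; apply Rabs_def1; lra.
Qed.

(** * Behaviour in the second variable *)

Lemma E_up (u y0 y : R) : E (u, y0) -> y0 < y -> E (u, y).
Proof.
intros HE Hy k Hk; generalize (HE k Hk); simpl fst; simpl snd; lra.
Qed.

Lemma is_lim_shift (f : R -> R) (c l : R) :
  is_lim f p_infty l -> is_lim (fun y => f (c + y)) p_infty l.
Proof.
intros H; apply is_lim_comp with p_infty; [exact H| |].
- apply is_lim_plus with c p_infty; [apply is_lim_const|apply is_lim_id|reflexivity].
- exists 0; intros; discriminate.
Qed.

Lemma head_lim_infty (g : R -> R) (g_convex : convex_pos g)
  (g_int : integrable_at_infinity g) (u : R) (N : nat) :
  is_lim (fun y => head g u y N) p_infty 0.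
Proof.
induction N as [|N IH].
- apply is_lim_ext with (fun _ => 0); [intros y; symmetry; apply head_0|].
  apply is_lim_const.
- apply is_lim_ext with (fun y => head g u y N + summand g u y (S N)).
  { intros y; symmetry; apply head_S. }
  replace (Finite 0) with (Finite (0 + 2 * (INR (S N) + u) * 0)) by (f_equal; ring).
  apply is_lim_plus'; [exact IH|].
  apply (is_lim_scal_l (fun y => g ((INR (S N) + u) ^ 2 + y)) _ p_infty 0).
  apply is_lim_shift, integrable_convex_lim; assumption.
Qed.

(** A fixed finite number of terms tends to 0 with [g], and the remainder is
    squeezed between 0 and a value of [Ftail g] at a point tending to
    infinity with [y]. *)
Lemma Ssum_lim_infty (g : R -> R) (g_convex : convex_pos g)
  (g_int : integrable_at_infinity g) (u0 y0 : R) :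
  E (u0, y0) -> is_lim (fun y => Ssum g u0 y) p_infty 0.
Proof.
intros HE.
destruct (locally_shift_large u0 y0 0 (Rle_refl 0)) as [N HN].
apply locally_singleton in HN; simpl fst in HN; simpl snd in HN.
destruct HN as (Hu & Hy); set (v := u0 + INR N) in *.
apply is_lim_le_le_loc with (fun y => head g u0 y N)
  (fun y => head g u0 y N + Ftail g (v ^ 2 + v + y)).
- exists y0; intros y Hyy.
  rewrite (Ssum_split g u0 y N)
    by (apply ex_series_E; auto; apply E_up with y0; auto).
  assert (Hy' : v ^ 2 + v + y > 0) by lra.
  generalize (proj1 (Ssum_le_Ftail g g_convex g_int v y Hu Hy')).
  generalize (Ssum_nonneg g g_convex g_int v y Hu (halfplane_of_cell _ _ Hu Hy')).
  fold v; lra.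
- apply head_lim_infty; assumption.
- replace (Finite 0) with (Finite (0 + 0)) by (f_equal; ring).
  apply is_lim_plus'; [apply head_lim_infty; assumption|].
  apply is_lim_shift, Ftail_lim; assumption.
Qed.

Lemma summand_decreasing (g : R -> R) (g_convex : convex_pos g)
  (g_int : integrable_at_infinity g) (u x y : R) (k : nat) :
  u >= -1 -> E (u, x) -> x < y -> (1 <= k)%nat -> summand g u y k <= summand g u x k.
Proof.
intros Hu HE Hxy Hk; apply Rmult_le_compat_l.
- generalize (INR_ge_1 k Hk); lra.
- apply integrable_convex_decreasing; auto; [apply HE; assumption|lra].
Qed.

Lemma Ssum_decreasing (g : R -> R) (g_convex : convex_pos g)
  (g_int : integrable_at_infinity g) (u x y : R) :
  u >= -1 -> - (1 + u) ^ 2 < x -> x < y -> Ssum g u y <= Ssum g u x.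
Proof.
intros Hu Hx Hxy; assert (HE := E_halfplane u x ltac:(lra) Hx).
apply Series_le; [|apply ex_series_E; auto].
intros n; split.
- apply summand_nonneg; auto; [apply E_up with x; auto|lia|].
  generalize (INR_ge_1 (S n) ltac:(lia)); lra.
- apply summand_decreasing; auto; lia.
Qed.

(** The first term vanishes for [u = -1], but the weight [2 (2 + u)] of the
    second one is always positive. *)
Lemma Ssum_strictly_decreasing (g : R -> R) (g_convex : convex_pos g)
  (g_int : integrable_at_infinity g) (g_pos : forall x, x > 0 -> g x > 0) (u x y : R) :
  u >= -1 -> - (1 + u) ^ 2 < x -> x < y -> Ssum g u y < Ssum g u x.
Proof.
intros Hu Hx Hxy; assert (HE := E_halfplane u x ltac:(lra) Hx).
rewrite (Ssum_split g u x 2), (Ssum_split g u y 2)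
  by (apply ex_series_E; auto; apply E_up with x; auto).
rewrite !head_S, !head_0.
assert (H1 := summand_decreasing g g_convex g_int u x y 1 Hu HE Hxy (le_n 1)).
assert (H2 : summand g u y 2 < summand g u x 2).
{ apply Rmult_lt_compat_l; [simpl; lra|].
  apply integrable_convex_strictly_decreasing; auto; [apply HE; lia|lra]. }
assert (H3 : Ssum g (u + INR 2) y <= Ssum g (u + INR 2) x).
{ apply Ssum_decreasing; auto; simpl; [lra|].
  assert (0 <= (1 + u) ^ 2 <= (1 + (u + (1 + 1))) ^ 2)
    by (split; [apply pow2_ge_0|apply pow_incr; lra]).
  lra. }
lra.
Qed.

Lemma Ssum_convex (g : R -> R) (g_convex : convex_pos g)
  (g_int : integrable_at_infinity g) (u : R) :
  u >= -1 -> convex_on (fun y => - (1 + u) ^ 2 < y) (fun y => Ssum g u y).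
Proof.
intros Hu x y lam Hx Hy Hlam.
assert (HEx := E_halfplane u x ltac:(lra) Hx); assert (HEy := E_halfplane u y ltac:(lra) Hy).
assert (Hsx := ex_series_E g g_convex g_int u x HEx).
assert (Hsy := ex_series_E g g_convex g_int u y HEy).
assert (Hxy : - (1 + u) ^ 2 < lam * x + (1 - lam) * y).
{ assert (0 < lam * (x + (1 + u) ^ 2)) by (apply Rmult_lt_0_compat; lra).
  assert (0 < (1 - lam) * (y + (1 + u) ^ 2)) by (apply Rmult_lt_0_compat; lra).
  lra. }
apply (ex_series_scal (V := R_NormedModule) lam) in Hsx.
apply (ex_series_scal (V := R_NormedModule) (1 - lam)) in Hsy.
unfold Ssum; rewrite <- !Series_scal_l, <- Series_plus by assumption.
apply Series_le.
- intros n; assert (Hn := INR_ge_1 (S n) ltac:(lia)); split.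
  + apply summand_nonneg; auto; [apply E_halfplane; auto; lra|lia|lra].
  + unfold summand; set (c := INR (S n) + u).
    replace (c ^ 2 + (lam * x + (1 - lam) * y)) with
      (lam * (c ^ 2 + x) + (1 - lam) * (c ^ 2 + y)) by ring.
    assert (H := g_convex (c ^ 2 + x) (c ^ 2 + y) lam
      (HEx (S n) ltac:(lia)) (HEy (S n) ltac:(lia)) Hlam).
    apply Rmult_le_compat_l with (r := 2 * c) in H; [|unfold c; lra].
    lra.
- apply (ex_series_plus (V := R_NormedModule) _ _ Hsx Hsy).
Qed.

Theorem theorem2p6 (g : R -> R)
  (g_convex : convex_on (fun x => 0 < x) g)
  (g_int : ex_RInt_gen g (at_point 1) (Rbar_locally p_infty)) :
  (* E is open, and S and F are well defined *)
  (open E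
   /\ (forall u y : R, E (u, y) ->
         ex_series (fun n : nat => summand g u y (S n)))
   /\ (forall t : R, 0 < t ->
         ex_RInt_gen g (at_point t) (Rbar_locally p_infty)))
  /\
  (* (1) *)
  (continuous_on E (fun p : R * R => Ssum g (fst p) (snd p))
   /\ (forall u0 y0 : R, E (u0, y0) ->
         (forall y : R, y > y0 -> E (u0, y))
         /\ is_lim (fun y => Ssum g u0 y) p_infty 0)
   /\ (forall u : R, u >= -1 ->
         (forall y : R, - (1 + u) ^ 2 < y -> 0 <= Ssum g u y)
         /\ convex_on (fun y => - (1 + u) ^ 2 < y) (fun y => Ssum g u y)
         /\ decreasing_on (fun y => - (1 + u) ^ 2 < y) (fun y => Ssum g u y))
   /\ ((forall x : R, x > 0 -> g x > 0) ->
       forall u : R, u >= -1 ->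
         strictly_decreasing_on (fun y => - (1 + u) ^ 2 < y)
           (fun y => Ssum g u y)))
  /\
  (* (2) *)
  ((forall u y : R, u >= -1 -> u ^ 2 + u + y > 0 ->
      (Ftail g ((1 + u) ^ 2 + y) + (1 / 2 + u) * g ((1 + u) ^ 2 + y)
         <= Ssum g u y <= Ftail g (u ^ 2 + u + y))
      /\ (Ssum g u y = Ftail g (u ^ 2 + u + y) <->
          (forall k : nat, (1 <= k)%nat ->
             linear_on_segment g
               ((INR k - 1 / 2 + u) ^ 2 + y - 1 / 4)
               ((INR (k + 1) - 1 / 2 + u) ^ 2 + y - 1 / 4))))
   /\
   (forall u y : R, u >= - (3 / 2) -> y > - (1 + u) ^ 2 ->
      Ftail g ((1 + u) ^ 2 + y) + (1 / 2 + u) * g ((1 + u) ^ 2 + y)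
        <= Ssum g u y
      /\ (Ftail g ((1 + u) ^ 2 + y) + (1 / 2 + u) * g ((1 + u) ^ 2 + y)
            = Ssum g u y ->
          forall k : nat, (1 <= k)%nat ->
            linear_on_segment g
              ((INR k + u) ^ 2 + y)
              ((INR (k + 1) + u) ^ 2 + y)))).
Proof.
repeat split.
- exact open_E.
- intros u y; apply ex_series_E; assumption.
- intros t; apply ex_RInt_gen_tail; assumption.
- intros p HE.
  apply (filterlim_filter_le_1 _ (filter_le_within (F := locally p) _)).
  apply continuous_Ssum; assumption.
- intros y Hy; apply E_up with y0; assumption.
- apply Ssum_lim_infty with y0; assumption.
- intros y Hy; apply Ssum_nonneg; assumption.
- apply Ssum_convex; assumption.
- intros x y Hx _ Hxy; apply Ssum_decreasing; assumption.
- intros g_pos u Hu x y Hx _ Hxy; apply Ssum_strictly_decreasing; assumption.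
- apply Ftail_le_Ssum; auto; lra.
- apply Ssum_le_Ftail; assumption.
- intros Heq k Hk; rewrite Nat.add_1_r.
  apply (Ssum_le_Ftail g); assumption.
- intros Hlin; apply Ssum_le_Ftail; auto.
  intros k Hk; specialize (Hlin k Hk); rewrite Nat.add_1_r in Hlin; exact Hlin.
- apply Ftail_le_Ssum; assumption.
- intros Heq k Hk; rewrite Nat.add_1_r.
  apply (Ftail_le_Ssum g); assumption.
Qed.
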